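(* Let $L>0$, $\sigma>0$ and $k\in\mathbb{C}$. Then $k$ is a transmission wavenumber if and only if $k$ satisfies $$(\sigma-1)\sin\Big((\sigma+1)\frac{kL}{2}\Big)=(\sigma+1)\sin\Big((\sigma-1)\frac{kL}{2}\Big)\qquad(\mathrm{A})$$ or $$(\sigma-1)\sin\Big((\sigma+1)\frac{kL}{2}\Big)=-(\sigma+1)\sin\Big((\sigma-1)\frac{kL}{2}\Big).\qquad(\mathrm{B})$$ Moreover, $k$ satisfies (A) if there exists an eigenfunction pair $(u,v)$ for $k$ consisting of odd functions of $x$, and $k$ satisfies (B) if there exists an eigenfunction pair $(u,v)$ for $k$ consisting of even functions of $x$.
   Context: For $k\in\mathbb{C}$, an eigenfunction pair for $k$ is a nontrivial pair $(u,v)\neq(0,0)$ of complex-valued functions on the interval $[-\frac L2,\frac L2]$ satisfying $$u''+k^{2}\sigma^{2}u=k^{2}(1-\sigma^{2})v,\qquad v''+k^{2}v=0,\qquad u(\pm\tfrac L2)=0,\quad u'(\pm\tfrac L2)=0$$ (no boundary condition is imposed on $v$). The number $k$ is called a transmission wavenumber if $k^2$ is an interior transmission eigenvalue, i.e. if an eigenfunction pair for $k$ exists. *)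

(* Defs.v *)
From Stdlib Require Import Reals.
From Coquelicot Require Import Coquelicot.
Open Scope R_scope.

Definition Cexp (z : C) : C :=
  (RtoC (exp (Re z)) * (cos (Im z), sin (Im z)))%C.

Definition Csin (z : C) : C :=
  ((Cexp (Ci * z) - Cexp (- (Ci * z))) / (2 * Ci))%C.

Definition interval (L : R) (x : R) : Prop := - (L / 2) <= x <= L / 2.

(* A function on [-L/2, L/2] is encoded by a function on R whose values outside
   the interval are irrelevant: every notion below only looks at the interval,
   and derivatives are one-sided at the endpoints. *)
Definition derivative_on (L : R) (f f' : R -> C) : Prop :=
  forall x, interval L x ->
    filterlim (fun y => ((f y - f x) / RtoC (y - x))%C)
              (within (interval L) (locally' x)) (locally (f' x)).

Definition nontrivial_on (L : R) (u v : R -> C) : Prop :=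
  exists x, interval L x /\ (u x <> 0%C \/ v x <> 0%C).

Definition odd_on (L : R) (f : R -> C) : Prop :=
  forall x, interval L x -> f (- x) = (- f x)%C.

Definition even_on (L : R) (f : R -> C) : Prop :=
  forall x, interval L x -> f (- x) = f x.

Definition eigenfunction_pair (L sigma : R) (k : C) (u v : R -> C) : Prop :=
  nontrivial_on L u v /\
  exists u' u'' v' v'' : R -> C,
    derivative_on L u u' /\ derivative_on L u' u'' /\
    derivative_on L v v' /\ derivative_on L v' v'' /\
    (forall x, interval L x ->
       (u'' x + k ^ 2 * RtoC sigma ^ 2 * u x
          = k ^ 2 * (1 - RtoC sigma ^ 2) * v x)%C) /\
    (forall x, interval L x -> (v'' x + k ^ 2 * v x = 0)%C) /\
    u (L / 2) = 0%C /\ u (- (L / 2)) = 0%C /\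
    u' (L / 2) = 0%C /\ u' (- (L / 2)) = 0%C.

(* The eigenvalue parameter enters the problem as k^2, so an eigenfunction pair
   for k is the same thing as one for the interior transmission eigenvalue k^2. *)
Definition transmission_wavenumber (L sigma : R) (k : C) : Prop :=
  exists u v : R -> C, eigenfunction_pair L sigma k u v.

Definition equation_A (L sigma : R) (k : C) : Prop :=
  ((RtoC sigma - 1) * Csin ((RtoC sigma + 1) * (k * RtoC L / 2))
     = (RtoC sigma + 1) * Csin ((RtoC sigma - 1) * (k * RtoC L / 2)))%C.

Definition equation_B (L sigma : R) (k : C) : Prop :=
  ((RtoC sigma - 1) * Csin ((RtoC sigma + 1) * (k * RtoC L / 2))
     = - ((RtoC sigma + 1) * Csin ((RtoC sigma - 1) * (k * RtoC L / 2))))%C.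

(* Main.v *)
Require Import Defs.
From Stdlib Require Import Reals Lra Classical.
From Coquelicot Require Import Coquelicot.
Open Scope R_scope.

(** The substitution w = u + v decouples the problem: w'' + (sigma k)^2 w = 0 and
    v'' + k^2 v = 0, and the boundary conditions on u say exactly that w and v
    have the same value and the same slope at both endpoints.

    For k <> 0, a solution of f'' + k^2 f = 0 on the interval is determined by
    f(0) and f'(0): factoring the operator as (D - ik)(D + ik), each of
    f' + ik f and f' - ik f is a multiple of an exponential, so
    k f(x) = k f(0) cos(kx) + f'(0) sin(kx) ([helmholtz_solution]).  Writing
    theta = k L/2 and Theta = sigma theta, sums and differences of the four matching
    conditions at +L/2 and -L/2 separate the even data (w(0), v(0)) from the odd
    data (w'(0), v'(0)) and leave two homogeneous 2x2 systems
    ([matching_conditions]).  A nontrivial pair has nonzero even data or nonzero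
    odd data, so one of the determinants vanishes, and by the addition formulas
    the odd determinant vanishes exactly when (A) holds, the even one exactly
    when (B) holds ([equation_A_iff], [equation_B_iff]).  An odd pair has no even
    data and an even pair has no odd data, which gives the two parity claims.

    Conversely a vanishing determinant yields a nonzero vector (p, q) in the
    kernel, and w = p sin(sigma k x), v = q sin(kx) for (A), or the same with
    cosines for (B), produces an eigenfunction pair (w - v, v).  At k = 0 both
    equations hold trivially, and the cosine construction still applies since it
    never divides by k. *)

(** * Complex arithmetic *)

Lemma RtoC_neq0 (r : R) : r <> 0 -> RtoC r <> 0%C.
Proof. intros h e; apply h; exact (RtoC_inj _ _ e). Qed.

Lemma Cmult_opp_r (z w : C) : (z * - w = - (z * w))%C.
Proof. ring. Qed.

Lemma Cmult_eq_0_reg_l (z w : C) : z <> 0%C -> (z * w = 0)%C -> w = 0%C.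
Proof.
intros hz h; apply NNPP; intros hw; exact (Cmult_neq_0 z w hz hw h).
Qed.

Lemma Cmult_eq_reg_l (c z w : C) : c <> 0%C -> (c * z = c * w)%C -> z = w.
Proof.
intros hc h; replace z with (w + (z - w))%C by ring.
rewrite (Cmult_eq_0_reg_l c (z - w) hc); [ring|].
replace (c * (z - w))%C with (c * z - c * w)%C by ring; rewrite h; ring.
Qed.

Lemma C2_neq0 : RtoC 2 <> 0%C.
Proof. apply RtoC_neq0; lra. Qed.

Lemma Ci_sqr : (Ci * Ci = - (1))%C.
Proof. apply injective_projections; simpl; ring. Qed.

Lemma Cdiv_RtoC (z : C) (r : R) : r <> 0 -> (z / RtoC r)%C = (Re z / r, Im z / r).
Proof.
intros h; destruct z as [a b]; unfold Cdiv, Cinv, Cmult, RtoC, Re, Im; simpl.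
f_equal; field; lra.
Qed.

(** * Calculus of one-sided derivatives on the interval *)

Lemma filterlim_Cplus {T : Type} (F : (T -> Prop) -> Prop) {FF : Filter F}
  (f g : T -> C) (a b : C) :
  filterlim f F (locally a) -> filterlim g F (locally b) ->
  filterlim (fun y => (f y + g y)%C) F (locally (a + b)%C).
Proof.
intros hf hg.
exact (filterlim_comp_2 _ _ _ hf hg (filterlim_plus (V := C_R_NormedModule) a b)).
Qed.

(** [filterlim_mult] speaks of the topology of the modulus; [locally_C] carries it to
    the product topology of the plane. *)
Lemma filterlim_Cmult {T : Type} (F : (T -> Prop) -> Prop) {FF : Filter F}
  (f g : T -> C) (a b : C) :
  filterlim f F (locally a) -> filterlim g F (locally b) ->
  filterlim (fun y => (f y * g y)%C) F (locally (a * b)%C).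
Proof.
intros hf hg P hP.
apply locally_C in hP.
refine (filterlim_comp_2 _ _ _ _ _ (filterlim_mult (K := C_AbsRing) a b) P hP).
- intros Q hQ; apply hf; now apply locally_C.
- intros Q hQ; apply hg; now apply locally_C.
Qed.

Lemma within_locally'_interval (L x : R) (P : R -> Prop) :
  (forall y, interval L y -> y <> x -> P y) ->
  within (interval L) (locally' x) P.
Proof. intros h; exists (mkposreal 1 Rlt_0_1); intros y _ hne hy; now apply h. Qed.

Lemma derivative_on_eq (L : R) (f g f' g' : R -> C) :
  (forall x, interval L x -> f x = g x) -> (forall x, interval L x -> f' x = g' x) ->
  derivative_on L f f' -> derivative_on L g g'.
Proof.
intros e e' h x hx.
rewrite <- (e' x hx).
refine (filterlim_ext_loc _ _ _ (h x hx)).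
apply within_locally'_interval; intros y hy _.
now rewrite (e x hx), (e y hy).
Qed.

Lemma derivative_on_const (L : R) (c : C) : derivative_on L (fun _ => c) (fun _ => 0%C).
Proof.
intros x hx.
refine (filterlim_ext_loc (fun _ => RtoC 0) _ _ (filterlim_const (RtoC 0))).
apply within_locally'_interval; intros y _ hne.
field; apply RtoC_neq0; lra.
Qed.

Lemma derivative_on_plus (L : R) (f g f' g' : R -> C) :
  derivative_on L f f' -> derivative_on L g g' ->
  derivative_on L (fun x => f x + g x)%C (fun x => f' x + g' x)%C.
Proof.
intros hf hg x hx.
refine (filterlim_ext_loc _ _ _ (filterlim_Cplus _ _ _ _ _ (hf x hx) (hg x hx))).
apply within_locally'_interval; intros y _ hne; cbv beta.
field; apply RtoC_neq0; lra.
Qed.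

Lemma filterlim_RtoC_minus (L x : R) :
  filterlim (fun y => RtoC (y - x)) (within (interval L) (locally' x)) (locally (RtoC 0)).
Proof.
intros P [d hd]; exists d; intros y hy hne hI.
apply hd; change (ball 0 d (y - x) /\ ball 0 d 0); split; simpl.
- unfold ball in *; simpl in *; unfold AbsRing_ball, abs, minus, plus, opp in *; simpl in *.
  replace (y - x + - 0) with (y + - x) by ring; exact hy.
- apply ball_center.
Qed.

Lemma derivative_on_continuous (L : R) (f f' : R -> C) (x : R) :
  derivative_on L f f' -> interval L x ->
  filterlim f (within (interval L) (locally' x)) (locally (f x)).
Proof.
intros hf hx.
replace (f x) with (f x + f' x * 0)%C by ring.
refine (filterlim_ext_loc _ _ _ (filterlim_Cplus _ _ _ _ _ (filterlim_const (f x))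
  (filterlim_Cmult _ _ _ _ _ (hf x hx) (filterlim_RtoC_minus L x)))).
apply within_locally'_interval; intros y _ hne; cbv beta.
field; apply RtoC_neq0; lra.
Qed.

Lemma derivative_on_mult (L : R) (f g f' g' : R -> C) :
  derivative_on L f f' -> derivative_on L g g' ->
  derivative_on L (fun x => f x * g x)%C (fun x => f' x * g x + f x * g' x)%C.
Proof.
intros hf hg x hx.
refine (filterlim_ext_loc _ _ _ (filterlim_Cplus _ _ _ _ _
  (filterlim_Cmult _ _ _ _ _ (hf x hx) (derivative_on_continuous _ _ _ x hg hx))
  (filterlim_Cmult _ _ _ _ _ (filterlim_const (f x)) (hg x hx)))).
apply within_locally'_interval; intros y _ hne; cbv beta.
field; apply RtoC_neq0; lra.
Qed.

Lemma derivative_on_scal (L : R) (c : C) (f f' : R -> C) :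
  derivative_on L f f' -> derivative_on L (fun x => c * f x)%C (fun x => c * f' x)%C.
Proof.
intros hf.
refine (derivative_on_eq _ _ _ _ _ _ _
  (derivative_on_mult _ _ _ _ _ (derivative_on_const L c) hf)); intros; simpl; ring.
Qed.

Lemma derivative_on_of_components (L : R) (f f' : R -> C) :
  (forall x, is_derive (fun y => Re (f y)) x (Re (f' x))) ->
  (forall x, is_derive (fun y => Im (f y)) x (Im (f' x))) ->
  derivative_on L f f'.
Proof.
intros hre him x hx.
apply filterlim_locally; intros eps.
destruct (proj1 (is_derive_Reals _ _ _) (hre x) eps (cond_pos eps)) as [d1 h1].
destruct (proj1 (is_derive_Reals _ _ _) (him x) eps (cond_pos eps)) as [d2 h2].
exists (mkposreal _ (Rmin_stable_in_posreal d1 d2)); intros y hy hne _.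
change (Rabs (y - x) < Rmin d1 d2) in hy.
assert (hd1 := Rlt_le_trans _ _ _ hy (Rmin_l _ _)).
assert (hd2 := Rlt_le_trans _ _ _ hy (Rmin_r _ _)).
assert (hr : y - x <> 0) by lra.
specialize (h1 _ hr hd1); specialize (h2 _ hr hd2).
rewrite Rplus_minus in h1, h2.
rewrite (Cdiv_RtoC _ _ hr).
split; assumption.
Qed.

(** Composing f with the projection of the line onto the interval gives a function
    on R: the projection is 1-Lipschitz, so the zero one-sided derivatives of f at
    the endpoints become two-sided ones, and the mean value theorem applies to
    the real and imaginary parts. *)
Lemma derivative_on_zero_constant (L : R) (f : R -> C) (x y : R) :
  derivative_on L f (fun _ => 0%C) -> interval L x -> interval L y -> f x = f y.
Proof.
intros hf hx hy.
set (clamp := fun t => Rmax (- (L / 2)) (Rmin (L / 2) t)).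
assert (hL : - (L / 2) <= L / 2) by (unfold interval in hx; lra).
assert (clamp_in : forall t, interval L (clamp t)).
{ intros t; unfold interval, clamp, Rmax, Rmin; repeat destruct Rle_dec; lra. }
assert (clamp_id : forall t, interval L t -> clamp t = t).
{ unfold interval; intros t ht; unfold clamp, Rmax, Rmin; repeat destruct Rle_dec; lra. }
assert (clamp_lip : forall s t, Rabs (clamp t - clamp s) <= Rabs (t - s)).
{ intros s t; unfold clamp, Rmax, Rmin, Rabs;
  repeat destruct Rle_dec; repeat destruct Rcase_abs; lra. }
assert (key : forall p : C -> R,
  (forall z r, r <> 0 -> p (z / RtoC r)%C = p z / r) ->
  (forall z w, p (z - w)%C = p z - p w) ->
  (forall z e, ball (RtoC 0 : C_UniformSpace) e z -> Rabs (p z) < e) ->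
  p (f x) = p (f y)).
{ intros p hdiv hsub hball.
  assert (hd : forall t, interval L t -> derivable_pt_lim (fun s => p (f (clamp s))) t 0).
  { intros t ht eps heps.
    destruct (proj1 (filterlim_locally _ _) (hf t ht) (mkposreal eps heps)) as [d h].
    exists d; intros r hr hrd.
    assert (hlip := clamp_lip t (t + r)).
    rewrite (clamp_id t ht) in hlip |- *.
    replace (t + r - t) with r in hlip by ring.
    rewrite Rminus_0_r.
    assert (hpos := Rabs_pos_lt _ hr).
    destruct (Req_dec (clamp (t + r)) t) as [e | hne].
    { rewrite e; unfold Rdiv; rewrite Rminus_diag, Rmult_0_l, Rabs_R0; exact heps. }
    assert (h' := hball _ _ (h (clamp (t + r)) (Rle_lt_trans _ _ _ hlip hrd) hne (clamp_in _))).
    rewrite hdiv, hsub in h' by lra.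
    refine (Rle_lt_trans _ _ _ _ h').
    unfold Rdiv; rewrite !Rabs_mult, !Rabs_inv.
    apply Rmult_le_compat_l; [apply Rabs_pos|].
    apply Rinv_le_contravar; [apply Rabs_pos_lt; lra | exact hlip]. }
  destruct (MVT_gen (fun s => p (f (clamp s))) x y (fun _ => 0)) as [c [_ hc]].
  - intros t ht; apply is_derive_Reals, hd.
    revert ht; unfold interval in *; unfold Rmax, Rmin; destruct Rle_dec; lra.
  - intros t ht; apply derivable_continuous_pt; exists 0; apply hd.
    revert ht; unfold interval in *; unfold Rmax, Rmin; destruct Rle_dec; lra.
  - rewrite (clamp_id x hx), (clamp_id y hy) in hc; lra. }
apply injective_projections.
- apply (key fst).
  + intros z r hr; now rewrite (Cdiv_RtoC _ _ hr).
  + intros z w; reflexivity.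
  + intros z e [h _]; change (Rabs (fst z - 0) < e) in h; now rewrite Rminus_0_r in h.
- apply (key snd).
  + intros z r hr; now rewrite (Cdiv_RtoC _ _ hr).
  + intros z w; reflexivity.
  + intros z e [_ h]; change (Rabs (snd z - 0) < e) in h; now rewrite Rminus_0_r in h.
Qed.

(** Limits along the interval are unique at an interior point, because the
    interval is there a full neighbourhood. *)
Lemma derivative_on_vanishing (L x : R) (f f' : R -> C) :
  derivative_on L f f' -> (forall y, interval L y -> f y = 0%C) ->
  - (L / 2) < x < L / 2 -> f' x = 0%C.
Proof.
intros hf h0 hx.
assert (hI : interval L x) by (unfold interval; lra).
assert (hnear : locally x (interval L)).
{ apply (locally_interval _ x (- (L / 2)) (L / 2)); simpl; try lra.
  unfold interval; intros; lra. }
refine (@filterlim_locally_unique R R_AbsRing C_R_NormedModule (locally' x) _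
  (fun y => (f y - f x) / RtoC (y - x))%C _ _ _ _).
- exact (Proper_StrongProper _ (Rbar_locally'_filter x)).
- intros P hP.
  generalize (hf x hI P hP); unfold filtermap, within, locally'.
  unfold within; intros hW; generalize (filter_and _ _ hnear hW).
  apply filter_imp; intros y [hy hPy] hne; now apply hPy.
- refine (filterlim_ext_loc (fun _ => RtoC 0) _ _ (filterlim_const (RtoC 0))).
  unfold locally', within; generalize hnear; apply filter_imp.
  intros y hy hne; rewrite (h0 x hI), (h0 y hy).
  field; apply RtoC_neq0; lra.
Qed.

Lemma derivative_on_reflection (L : R) (f f' : R -> C) :
  derivative_on L f f' -> derivative_on L (fun x => f (- x)) (fun x => - f' (- x)%R)%C.
Proof.
intros hf x hx.
assert (hx' : interval L (- x)) by (unfold interval in *; lra).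
replace (- f' (- x)%R)%C with (RtoC (- (1)) * f' (- x)%R)%C
  by (rewrite RtoC_opp; ring).
refine (filterlim_ext_loc _ _ _ (filterlim_Cmult _ _ _ _ _ (filterlim_const (RtoC (- (1))))
  (filterlim_comp _ _ _ Ropp _ _ _ _ _ (hf (- x) hx')))).
- apply within_locally'_interval; intros y _ hne; cbv beta.
  replace (- y - - x) with (- (y - x)) by ring.
  rewrite !RtoC_opp; field; apply RtoC_neq0; lra.
- intros P [d hd]; exists d; intros y hy hne hI.
  apply hd; [| lra | unfold interval in *; lra].
  change (Rabs (y - x) < d) in hy; change (Rabs (- y - - x) < d).
  replace (- y - - x) with (- (y - x)) by ring; now rewrite Rabs_Ropp.
Qed.

(** The derivative of an even function is odd, hence vanishes at the centre; here
    f(x) - f(-x) is identically zero and has derivative 2 f'(0) at 0. *)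
Lemma derivative_on_even (L : R) (f f' : R -> C) :
  0 < L -> derivative_on L f f' -> even_on L f -> f' 0 = 0%C.
Proof.
intros hL hf he.
assert (h := derivative_on_vanishing L 0 _ _
  (derivative_on_plus _ _ _ _ _ hf
    (derivative_on_scal _ (- (1))%C _ _ (derivative_on_reflection _ _ _ hf)))).
cbv beta in h; rewrite Ropp_0 in h.
apply (Cmult_eq_0_reg_l (RtoC 2)); [exact C2_neq0|].
rewrite <- h; [ring | | lra].
intros y hy; rewrite (he y hy); ring.
Qed.

(** * Complex exponential, sine and cosine *)

Lemma Cexp_plus (z w : C) : Cexp (z + w)%C = (Cexp z * Cexp w)%C.
Proof.
destruct z as [a b], w as [c d]; unfold Cexp, Cmult, RtoC, Re, Im; simpl.
rewrite exp_plus, cos_plus, sin_plus; f_equal; ring.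
Qed.

Lemma Cexp_0 : Cexp 0 = 1%C.
Proof.
unfold Cexp, Cmult, RtoC, Re, Im; simpl.
rewrite exp_0, cos_0, sin_0; f_equal; ring.
Qed.

Lemma derivative_on_Cexp (L : R) (a : C) :
  derivative_on L (fun x => Cexp (a * RtoC x)) (fun x => a * Cexp (a * RtoC x))%C.
Proof.
destruct a as [a b]; apply derivative_on_of_components; intros x;
  unfold Cexp, Cmult, RtoC, Re, Im; simpl; (auto_derive; [trivial|]); unfold Rminus; ring.
Qed.

Definition Ccos (z : C) : C := ((Cexp (Ci * z) + Cexp (- (Ci * z))) / 2)%C.

(** Dividing by i is multiplying by -i; in this form the only relation that
    involves i in later computations is i^2 = -1. *)
Lemma Csin_eq (z : C) : Csin z = (- Ci * (Cexp (Ci * z) - Cexp (- (Ci * z))) / 2)%C.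
Proof.
rewrite <- Ci_inv; unfold Csin.
field; exact Ci_nz.
Qed.

Lemma Csin_plus (z w : C) : (Csin (z + w) = Csin z * Ccos w + Ccos z * Csin w)%C.
Proof.
rewrite !Csin_eq; unfold Ccos.
replace (Ci * (z + w))%C with (Ci * z + Ci * w)%C by ring.
replace (- (Ci * z + Ci * w))%C with (- (Ci * z) + - (Ci * w))%C by ring.
rewrite !Cexp_plus; field.
Qed.

Lemma Csin_opp (z : C) : (Csin (- z) = - Csin z)%C.
Proof.
rewrite !Csin_eq.
replace (Ci * - z)%C with (- (Ci * z))%C by ring.
replace (- - (Ci * z))%C with (Ci * z)%C by ring.
field.
Qed.

Lemma Ccos_opp (z : C) : Ccos (- z) = Ccos z.
Proof.
unfold Ccos.
replace (Ci * - z)%C with (- (Ci * z))%C by ring.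
replace (- - (Ci * z))%C with (Ci * z)%C by ring.
field.
Qed.

Lemma Ccos_0 : Ccos 0 = 1%C.
Proof.
unfold Ccos.
replace (Ci * 0)%C with (RtoC 0) by ring.
replace (- RtoC 0)%C with (RtoC 0) by ring.
rewrite Cexp_0; field.
Qed.

(** The exponents are put in the form (constant) * x that the derivative of the
    exponential expects. *)
Lemma Ccos_at (z : C) (r : R) :
  Ccos (z * RtoC r) = ((Cexp (Ci * z * RtoC r) + Cexp (- (Ci * z) * RtoC r)) / 2)%C.
Proof. unfold Ccos; do 3 f_equal; ring. Qed.

Lemma Csin_at (z : C) (r : R) :
  Csin (z * RtoC r)
    = (- Ci * (Cexp (Ci * z * RtoC r) - Cexp (- (Ci * z) * RtoC r)) / 2)%C.
Proof.
rewrite Csin_eq.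
replace (- (Ci * (z * RtoC r)))%C with (- (Ci * z) * RtoC r)%C by ring.
replace (Ci * (z * RtoC r))%C with (Ci * z * RtoC r)%C by ring.
reflexivity.
Qed.

Lemma derivative_on_Csin (L : R) (k : C) :
  derivative_on L (fun x => Csin (k * RtoC x)) (fun x => k * Ccos (k * RtoC x))%C.
Proof.
refine (derivative_on_eq _ _ _ _ _ _ _
  (derivative_on_plus _ _ _ _ _
    (derivative_on_scal _ (- Ci / 2)%C _ _ (derivative_on_Cexp L (Ci * k)))
    (derivative_on_scal _ (Ci / 2)%C _ _ (derivative_on_Cexp L (- (Ci * k))))));
  intros x _; cbv beta.
- rewrite Csin_at; field.
- rewrite Ccos_at.
  replace (- Ci / 2 * (Ci * k * Cexp (Ci * k * x)) +
    Ci / 2 * (- (Ci * k) * Cexp (- (Ci * k) * x)))%C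
    with (- (Ci * Ci) * k * (Cexp (Ci * k * x) + Cexp (- (Ci * k) * x)) / 2)%C
    by field.
  rewrite Ci_sqr; field.
Qed.

Lemma derivative_on_Ccos (L : R) (k : C) :
  derivative_on L (fun x => Ccos (k * RtoC x)) (fun x => - k * Csin (k * RtoC x))%C.
Proof.
refine (derivative_on_eq _ _ _ _ _ _ _
  (derivative_on_plus _ _ _ _ _
    (derivative_on_scal _ (/ 2)%C _ _ (derivative_on_Cexp L (Ci * k)))
    (derivative_on_scal _ (/ 2)%C _ _ (derivative_on_Cexp L (- (Ci * k))))));
  intros x _; cbv beta.
- rewrite Ccos_at; field.
- rewrite Csin_at; field.
Qed.

(** * The equation f'' + k^2 f = 0 *)

(** The product of f with exp(-ax) has zero derivative. *)
Lemma linear_ode_solution (L : R) (a : C) (f f' : R -> C) (x : R) :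
  derivative_on L f f' -> (forall y, interval L y -> f' y = (a * f y)%C) ->
  interval L x -> f x = (f 0 * Cexp (a * RtoC x))%C.
Proof.
intros hf he hx.
assert (h0 : interval L 0) by (unfold interval in *; lra).
assert (hc := derivative_on_zero_constant L (fun y => f y * Cexp (- a * RtoC y))%C x 0).
assert (hinv : (Cexp (- a * RtoC x) * Cexp (a * RtoC x))%C = 1%C).
{ rewrite <- Cexp_plus, <- Cexp_0; f_equal; ring. }
cbv beta in hc; rewrite Cmult_0_r, Cexp_0, Cmult_1_r in hc.
rewrite <- hc; trivial.
- rewrite <- Cmult_assoc, hinv; ring.
- refine (derivative_on_eq _ _ _ _ _ _ _
    (derivative_on_mult _ _ _ _ _ hf (derivative_on_Cexp L (- a)))); trivial.
  intros y hy; rewrite (he y hy); ring.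
Qed.

Definition helmholtz (L : R) (k : C) (f f' : R -> C) : Prop :=
  derivative_on L f f' /\ derivative_on L f' (fun x => - (k ^ 2 * f x))%C.

(** One factor of D^2 + k^2 = (D - c)(D + c), where c is ik or -ik. *)
Lemma helmholtz_factor (L : R) (k c : C) (f f' : R -> C) (x : R) :
  helmholtz L k f f' -> (c * c = - k ^ 2)%C -> interval L x ->
  (f' x + c * f x = (f' 0 + c * f 0) * Cexp (c * RtoC x))%C.
Proof.
intros [h1 h2] hc hx.
refine (linear_ode_solution L c (fun y => f' y + c * f y)%C _ x
  (derivative_on_plus _ _ _ _ _ h2 (derivative_on_scal _ c _ _ h1)) _ hx).
intros y _; cbv beta.
replace (c * (f' y + c * f y))%C with (c * c * f y + c * f' y)%C by ring.
rewrite hc; ring.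
Qed.

(** Half the difference and half the sum of f' + ikf and f' - ikf are ikf and f',
    and each of the two combinations is an exponential by [helmholtz_factor]. *)
Lemma helmholtz_solution (L : R) (k : C) (f f' : R -> C) (x : R) :
  helmholtz L k f f' -> interval L x ->
  (k * f x = k * f 0 * Ccos (k * RtoC x) + f' 0 * Csin (k * RtoC x))%C /\
  (f' x = f' 0 * Ccos (k * RtoC x) - k * f 0 * Csin (k * RtoC x))%C.
Proof.
intros hf hx.
assert (hp := helmholtz_factor L k (Ci * k) f f' x hf).
assert (hm := helmholtz_factor L k (- (Ci * k)) f f' x hf).
rewrite Ccos_at, Csin_at.
set (E := Cexp _) in *; set (E' := Cexp (- _ * _)) in *.
assert (hi := Ci_sqr).
assert (hp' : (f' x + Ci * k * f x = (f' 0 + Ci * k * f 0) * E)%C).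
{ apply hp; [ring [hi] | exact hx]. }
assert (hm' : (f' x + - (Ci * k) * f x = (f' 0 + - (Ci * k) * f 0) * E')%C).
{ apply hm; [ring [hi] | exact hx]. }
split.
- transitivity (- Ci * ((f' x + Ci * k * f x) - (f' x + - (Ci * k) * f x)) / 2)%C.
  + field [hi].
  + rewrite hp', hm'; field [hi].
- transitivity (((f' x + Ci * k * f x) + (f' x + - (Ci * k) * f x)) / 2)%C.
  + field.
  + rewrite hp', hm'; field [hi].
Qed.

Lemma helmholtz_unique (L : R) (k : C) (f f' : R -> C) (x : R) :
  k <> 0%C -> helmholtz L k f f' -> f 0 = 0%C -> f' 0 = 0%C -> interval L x ->
  f x = 0%C.
Proof.
intros hk hf h0 h0' hx; apply (Cmult_eq_0_reg_l k _ hk).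
rewrite (proj1 (helmholtz_solution _ _ _ _ _ hf hx)), h0, h0'; ring.
Qed.

Lemma helmholtz_sin (L : R) (k p : C) :
  helmholtz L k (fun x => p * Csin (k * RtoC x))%C (fun x => p * (k * Ccos (k * RtoC x)))%C.
Proof.
split; [apply derivative_on_scal, derivative_on_Csin|].
refine (derivative_on_eq _ _ _ _ _ _ _
  (derivative_on_scal _ (p * k)%C _ _ (derivative_on_Ccos L k))); intros x _; ring.
Qed.

Lemma helmholtz_cos (L : R) (k p : C) :
  helmholtz L k (fun x => p * Ccos (k * RtoC x))%C (fun x => p * (- k * Csin (k * RtoC x)))%C.
Proof.
split; [apply derivative_on_scal, derivative_on_Ccos|].
refine (derivative_on_eq _ _ _ _ _ _ _
  (derivative_on_scal _ (p * - k)%C _ _ (derivative_on_Csin L k))); intros x _; ring.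
Qed.

(** * Characteristic determinants *)

Lemma homogeneous_2x2_singular (a b c d p q : C) :
  ~ (p = 0%C /\ q = 0%C) -> (p * a = q * b)%C -> (p * c = q * d)%C ->
  (a * d = b * c)%C.
Proof.
intros hpq h1 h2.
assert (hp : (p * (a * d - b * c) = 0)%C).
{ replace (p * (a * d - b * c))%C with (p * a * d - b * (p * c))%C by ring.
  rewrite h1, h2; ring. }
assert (hq : (q * (a * d - b * c) = 0)%C).
{ replace (q * (a * d - b * c))%C with (a * (q * d) - (q * b) * c)%C by ring.
  rewrite <- h1, <- h2; ring. }
assert (h : (a * d - b * c = 0)%C).
{ destruct (Ceq_dec p 0) as [e | e].
  - apply (Cmult_eq_0_reg_l q); [tauto | exact hq].
  - exact (Cmult_eq_0_reg_l _ _ e hp). }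
replace (a * d)%C with ((a * d - b * c) + b * c)%C by ring; rewrite h; ring.
Qed.

(** The kernel vector is (b, a), or (d, c) if the first equation is void, or
    anything if both are. *)
Lemma homogeneous_2x2_solvable (a b c d : C) :
  (a * d = b * c)%C ->
  exists p q : C, ~ (p = 0%C /\ q = 0%C) /\ (p * a = q * b)%C /\ (p * c = q * d)%C.
Proof.
intros h.
destruct (classic (b = 0%C /\ a = 0%C)) as [[eb ea] | hab].
- destruct (classic (d = 0%C /\ c = 0%C)) as [[ed ec] | hcd].
  + exists (RtoC 1), (RtoC 0); subst; repeat split; try ring.
    intros [e _]; exact (C1_nz e).
  + exists d, c; subst; repeat split; try ring; exact hcd.
- exists b, a; repeat split; [exact hab | ring | now rewrite h].
Qed.

Lemma Csin_sum_difference (L sigma : R) (k : C) :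
  let theta := (k * RtoC (L / 2))%C in
  let Theta := (RtoC sigma * k * RtoC (L / 2))%C in
  (Csin ((RtoC sigma + 1) * (k * RtoC L / 2))
     = Csin Theta * Ccos theta + Ccos Theta * Csin theta)%C /\
  (Csin ((RtoC sigma - 1) * (k * RtoC L / 2))
     = Csin Theta * Ccos theta - Ccos Theta * Csin theta)%C.
Proof.
intros theta Theta.
replace ((RtoC sigma + 1) * (k * RtoC L / 2))%C with (Theta + theta)%C.
2: { unfold Theta, theta; rewrite RtoC_div by lra; field. }
replace ((RtoC sigma - 1) * (k * RtoC L / 2))%C with (Theta + - theta)%C.
2: { unfold Theta, theta; rewrite RtoC_div by lra; field. }
rewrite !Csin_plus, Csin_opp, Ccos_opp; split; ring.
Qed.

(** Expanding the sines, the two sides of (A) differ by twice the determinant of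
    the system for the odd data. *)
Lemma equation_A_iff (L sigma : R) (k : C) :
  let theta := (k * RtoC (L / 2))%C in
  let Theta := (RtoC sigma * k * RtoC (L / 2))%C in
  equation_A L sigma k <->
  (Csin Theta * Ccos theta = Csin theta * (RtoC sigma * Ccos Theta))%C.
Proof.
intros theta Theta; unfold equation_A.
destruct (Csin_sum_difference L sigma k) as [-> ->].
fold theta Theta.
set (s := Csin Theta); set (c := Ccos Theta); set (s' := Csin theta); set (c' := Ccos theta).
split; intros h.
- apply (Cmult_eq_reg_l (RtoC 2)); [exact C2_neq0|].
  transitivity ((RtoC sigma + 1) * (s * c' - c * s') - (RtoC sigma - 1) * (s * c' + c * s')
    + 2 * (s' * (RtoC sigma * c)))%C; [ring|].
  rewrite h; ring.
- transitivity ((RtoC sigma + 1) * (s * c' - c * s')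
    + 2 * (s' * (RtoC sigma * c) - s * c'))%C; [ring|].
  rewrite h; ring.
Qed.

(** As for (A), with the determinant of the system for the even data. *)
Lemma equation_B_iff (L sigma : R) (k : C) :
  let theta := (k * RtoC (L / 2))%C in
  let Theta := (RtoC sigma * k * RtoC (L / 2))%C in
  equation_B L sigma k <->
  (Ccos Theta * Csin theta = Ccos theta * (RtoC sigma * Csin Theta))%C.
Proof.
intros theta Theta; unfold equation_B.
destruct (Csin_sum_difference L sigma k) as [-> ->].
fold theta Theta.
set (s := Csin Theta); set (c := Ccos Theta); set (s' := Csin theta); set (c' := Ccos theta).
split; intros h.
- apply (Cmult_eq_reg_l (RtoC 2)); [exact C2_neq0|].
  transitivity (- ((RtoC sigma + 1) * (s * c' - c * s')) - (RtoC sigma - 1) * (s * c' + c * s')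
    + 2 * (c' * (RtoC sigma * s)))%C; [ring|].
  rewrite h; ring.
- transitivity (- ((RtoC sigma + 1) * (s * c' - c * s'))
    + 2 * (c' * (RtoC sigma * s) - c * s'))%C; [ring|].
  rewrite h; ring.
Qed.

(** * From eigenfunction pairs to the characteristic equations *)

(** Adding and subtracting the conditions at L/2 and -L/2 separates the cosine
    coefficients from the sine coefficients of the solution formula. *)
Lemma matching_conditions (L sigma : R) (k : C) (w w' v v' : R -> C) :
  let theta := (k * RtoC (L / 2))%C in
  let Theta := (RtoC sigma * k * RtoC (L / 2))%C in
  0 < L -> sigma <> 0 -> k <> 0%C ->
  helmholtz L (RtoC sigma * k) w w' -> helmholtz L k v v' ->
  w (L / 2) = v (L / 2) -> w (- (L / 2)) = v (- (L / 2)) ->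
  w' (L / 2) = v' (L / 2) -> w' (- (L / 2)) = v' (- (L / 2)) ->
  ((w 0 * Ccos Theta = v 0 * Ccos theta)%C /\
   (w 0 * (RtoC sigma * Csin Theta) = v 0 * Csin theta)%C) /\
  ((w' 0 * Csin Theta = v' 0 * (RtoC sigma * Csin theta))%C /\
   (w' 0 * Ccos Theta = v' 0 * Ccos theta)%C).
Proof.
intros theta Theta hL hs hk hw hv e1 e2 e3 e4.
assert (ip : interval L (L / 2)) by (unfold interval; lra).
assert (im : interval L (- (L / 2))) by (unfold interval; lra).
destruct (helmholtz_solution _ _ _ _ _ hw ip) as [wp wp'].
destruct (helmholtz_solution _ _ _ _ _ hw im) as [wm wm'].
destruct (helmholtz_solution _ _ _ _ _ hv ip) as [vp vp'].
destruct (helmholtz_solution _ _ _ _ _ hv im) as [vm vm'].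
rewrite e1 in wp; rewrite e2 in wm; rewrite e3 in wp'; rewrite e4 in wm'.
rewrite RtoC_opp in wm, wm', vm, vm'.
replace (RtoC sigma * k * - RtoC (L / 2))%C with (- Theta)%C in wm, wm' by (unfold Theta; ring).
replace (k * - RtoC (L / 2))%C with (- theta)%C in vm, vm' by (unfold theta; ring).
fold Theta in wp, wp'; fold theta in vp, vp'.
rewrite Csin_opp, Ccos_opp in wm, wm', vm, vm'.
assert (hsk : (2 * (RtoC sigma * k))%C <> 0%C).
{ apply Cmult_neq_0; [exact C2_neq0|]; apply Cmult_neq_0; [now apply RtoC_neq0 | exact hk]. }
assert (h2k : (2 * k)%C <> 0%C) by (apply Cmult_neq_0; [exact C2_neq0 | exact hk]).
repeat split.
- apply (Cmult_eq_reg_l _ _ _ hsk).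
  transitivity (RtoC sigma * k * v (L / 2)%R + RtoC sigma * k * v (- (L / 2))%R)%C.
  + rewrite wp, wm; ring.
  + rewrite <- !Cmult_assoc, vp, vm; ring.
- apply (Cmult_eq_reg_l _ _ _ h2k).
  transitivity (v' (- (L / 2))%R - v' (L / 2)%R)%C.
  + rewrite wp', wm'; ring.
  + rewrite vp', vm'; ring.
- apply (Cmult_eq_reg_l _ _ _ C2_neq0).
  transitivity (RtoC sigma * k * v (L / 2)%R - RtoC sigma * k * v (- (L / 2))%R)%C.
  + rewrite wp, wm; ring.
  + rewrite <- !Cmult_assoc, vp, vm; ring.
- apply (Cmult_eq_reg_l _ _ _ C2_neq0).
  transitivity (v' (L / 2)%R + v' (- (L / 2))%R)%C.
  + rewrite wp', wm'; ring.
  + rewrite vp', vm'; ring.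
Qed.

(** The determinants of the systems for (w, v), with w = u + v, vanish as soon as the
    corresponding data are nonzero; nonzero data may be read off (u, v) as well,
    since (u + v, v) and (u, v) vanish together.  The last clause is uniqueness for
    the initial value problem at 0. *)
Lemma eigenfunction_pair_dichotomy (L sigma : R) (k : C) (u v : R -> C) :
  0 < L -> sigma <> 0 -> k <> 0%C -> eigenfunction_pair L sigma k u v ->
  exists u' v' : R -> C,
    derivative_on L u u' /\ derivative_on L v v' /\
    (~ (u' 0 = 0%C /\ v' 0 = 0%C) -> equation_A L sigma k) /\
    (~ (u 0 = 0%C /\ v 0 = 0%C) -> equation_B L sigma k) /\
    ~ ((u 0 = 0%C /\ v 0 = 0%C) /\ (u' 0 = 0%C /\ v' 0 = 0%C)).
Proof.
intros hL hs hk [[x [hx hne]]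
  [u' [u'' [v' [v'' [hu [hu' [hv [hv' [equ [eqv [b1 [b2 [b3 b4]]]]]]]]]]]]]].
assert (hv_h : helmholtz L k v v').
{ split; [exact hv|]; refine (derivative_on_eq _ _ _ _ _ _ _ hv'); trivial.
  intros y hy; replace (v'' y) with (v'' y + k ^ 2 * v y - k ^ 2 * v y)%C by ring.
  rewrite (eqv y hy); ring. }
assert (hw_h : helmholtz L (RtoC sigma * k) (fun y => u y + v y)%C (fun y => u' y + v' y)%C).
{ split; [now apply derivative_on_plus|].
  refine (derivative_on_eq _ _ _ _ _ _ _ (derivative_on_plus _ _ _ _ _ hu' hv')); trivial.
  intros y hy; cbv beta.
  transitivity ((u'' y + k ^ 2 * RtoC sigma ^ 2 * u y) + (v'' y + k ^ 2 * v y)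
    - k ^ 2 * RtoC sigma ^ 2 * u y - k ^ 2 * v y)%C; [ring|].
  rewrite (equ y hy), (eqv y hy); ring. }
destruct (matching_conditions L sigma k _ _ _ _ hL hs hk hw_h hv_h) as [[m1 m2] [m3 m4]];
  [rewrite b1; ring | rewrite b2; ring | rewrite b3; ring | rewrite b4; ring |].
cbv beta in *.
assert (shift : forall a b : C, ~ (a = 0%C /\ b = 0%C) -> ~ ((a + b)%C = 0%C /\ b = 0%C)).
{ intros a b h [e1 e2]; apply h; split; [|exact e2].
  rewrite <- e1, e2; ring. }
exists u', v'; repeat split; trivial.
- intros h; apply equation_A_iff.
  rewrite (homogeneous_2x2_singular _ _ _ _ _ _ (shift _ _ h) m3 m4); ring.
- intros h; apply equation_B_iff.
  exact (homogeneous_2x2_singular _ _ _ _ _ _ (shift _ _ h) m1 m2).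
- intros [[u0 v0] [u0' v0']].
  assert (vx : v x = 0%C) by exact (helmholtz_unique _ _ _ _ _ hk hv_h v0 v0' hx).
  assert (wx : (u x + v x)%C = 0%C).
  { refine (helmholtz_unique _ _ _ _ _ _ hw_h _ _ hx); cbv beta.
    - apply Cmult_neq_0; [now apply RtoC_neq0 | exact hk].
    - rewrite u0, v0; ring.
    - rewrite u0', v0'; ring. }
  destruct hne as [h | h]; apply h; [|exact vx].
  rewrite <- wx, vx; ring.
Qed.

(** * From the characteristic equations to eigenfunction pairs *)

(** Inverse of the substitution w = u + v. *)
Lemma transmission_wavenumber_of_helmholtz (L sigma : R) (k : C) (w w' v v' : R -> C) (x : R) :
  helmholtz L (RtoC sigma * k) w w' -> helmholtz L k v v' ->
  w (L / 2) = v (L / 2) -> w (- (L / 2)) = v (- (L / 2)) ->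
  w' (L / 2) = v' (L / 2) -> w' (- (L / 2)) = v' (- (L / 2)) ->
  interval L x -> ~ (w x = 0%C /\ v x = 0%C) ->
  transmission_wavenumber L sigma k.
Proof.
intros [hw hw'] [hv hv'] e1 e2 e3 e4 hx hne.
exists (fun y => w y + - (1) * v y)%C, v; split.
- exists x; split; [exact hx|].
  apply NNPP; intros h; apply not_or_and in h; destruct h as [h1 h2].
  apply NNPP in h1; apply NNPP in h2; apply hne; split; [|exact h2].
  rewrite <- h1, h2; ring.
- exists (fun y => w' y + - (1) * v' y)%C.
  exists (fun y => - ((RtoC sigma * k) ^ 2 * w y) + - (1) * - (k ^ 2 * v y))%C.
  exists v', (fun y => - (k ^ 2 * v y))%C.
  split; [now apply derivative_on_plus, derivative_on_scal|].
  split; [now apply derivative_on_plus, derivative_on_scal|].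
  split; [exact hv|]; split; [exact hv'|].
  split; [intros y _; ring|]; split; [intros y _; ring|].
  rewrite e1, e2, e3, e4; repeat split; ring.
Qed.

(** The pair comes from w = p sin(sigma k x) and v = q sin(kx).  It is nontrivial
    because otherwise the derivatives p sigma k and q k at 0 would vanish. *)
Lemma transmission_wavenumber_of_A (L sigma : R) (k : C) :
  0 < L -> sigma <> 0 -> k <> 0%C -> equation_A L sigma k ->
  transmission_wavenumber L sigma k.
Proof.
intros hL hs hk hA; apply equation_A_iff in hA.
destruct (homogeneous_2x2_solvable _ _ _ _ hA) as [p [q [hpq [h1 h2]]]].
assert (hw := helmholtz_sin L (RtoC sigma * k) p).
assert (hv := helmholtz_sin L k q).
apply NNPP; intros hno.
assert (h0 : forall x, interval L x ->
  (p * Csin (RtoC sigma * k * RtoC x) = 0)%C /\ (q * Csin (k * RtoC x) = 0)%C).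
{ intros x hx; apply NNPP; intros hne; apply hno.
  refine (transmission_wavenumber_of_helmholtz L sigma k _ _ _ _ x hw hv _ _ _ _ hx hne);
    cbv beta; rewrite ?RtoC_opp, ?Cmult_opp_r.
  - exact h1.
  - rewrite !Csin_opp, !Cmult_opp_r; now f_equal.
  - transitivity (k * (p * (RtoC sigma * Ccos (RtoC sigma * k * RtoC (L / 2)))))%C; [ring|].
    rewrite h2; ring.
  - rewrite !Ccos_opp.
    transitivity (k * (p * (RtoC sigma * Ccos (RtoC sigma * k * RtoC (L / 2)))))%C; [ring|].
    rewrite h2; ring. }
assert (hmid : - (L / 2) < 0 < L / 2) by lra.
assert (w0 := derivative_on_vanishing L 0 _ _ (proj1 hw) (fun x hx => proj1 (h0 x hx)) hmid).
assert (v0 := derivative_on_vanishing L 0 _ _ (proj1 hv) (fun x hx => proj2 (h0 x hx)) hmid).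
cbv beta in w0, v0; rewrite Cmult_0_r, Ccos_0 in w0, v0.
apply hpq; split.
- apply (Cmult_eq_0_reg_l (RtoC sigma * k)%C).
  + apply Cmult_neq_0; [now apply RtoC_neq0 | exact hk].
  + rewrite <- w0; ring.
- apply (Cmult_eq_0_reg_l k _ hk); rewrite <- v0; ring.
Qed.

(** The pair comes from w = p cos(sigma k x) and v = q cos(kx), whose values (p, q) at 0
    show that it is nontrivial, even for k = 0. *)
Lemma transmission_wavenumber_of_B (L sigma : R) (k : C) :
  0 < L -> equation_B L sigma k -> transmission_wavenumber L sigma k.
Proof.
intros hL hB; apply equation_B_iff in hB.
destruct (homogeneous_2x2_solvable _ _ _ _ hB) as [p [q [hpq [h1 h2]]]].
refine (transmission_wavenumber_of_helmholtz L sigma k _ _ _ _ 0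
  (helmholtz_cos L (RtoC sigma * k) p) (helmholtz_cos L k q) _ _ _ _ _ _);
  cbv beta; rewrite ?RtoC_opp, ?Cmult_opp_r.
- exact h1.
- rewrite !Ccos_opp; exact h1.
- transitivity (- k * (p * (RtoC sigma * Csin (RtoC sigma * k * RtoC (L / 2)))))%C; [ring|].
  rewrite h2; ring.
- rewrite !Csin_opp.
  transitivity (k * (p * (RtoC sigma * Csin (RtoC sigma * k * RtoC (L / 2)))))%C; [ring|].
  rewrite h2; ring.
- unfold interval; lra.
- rewrite !Cmult_0_r, Ccos_0, !Cmult_1_r; exact hpq.
Qed.

(** * Proof of the proposition *)

Lemma equations_at_0 (L sigma : R) : equation_A L sigma 0 /\ equation_B L sigma 0.
Proof.
assert (Csin_0 : Csin 0 = 0%C).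
{ rewrite Csin_eq, !Cmult_0_r; replace (- RtoC 0)%C with (RtoC 0) by ring.
  field. }
split; [apply equation_A_iff | apply equation_B_iff];
  rewrite !Cmult_0_r, !Cmult_0_l, Csin_0; ring.
Qed.

Theorem proposition4 (L sigma : R) (k : C) (hL : 0 < L) (hsigma : 0 < sigma) :
  (transmission_wavenumber L sigma k <->
     equation_A L sigma k \/ equation_B L sigma k) /\
  ((exists u v : R -> C,
      eigenfunction_pair L sigma k u v /\ odd_on L u /\ odd_on L v) ->
   equation_A L sigma k) /\
  ((exists u v : R -> C,
      eigenfunction_pair L sigma k u v /\ even_on L u /\ even_on L v) ->
   equation_B L sigma k).
Proof.
assert (hs : sigma <> 0) by lra.
destruct (Ceq_dec k 0) as [-> | hk].
{ destruct (equations_at_0 L sigma) as [hA hB].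
  split; [split|split]; auto.
  intros _; now apply transmission_wavenumber_of_B. }
split; [split | split].
- intros [u [v huv]].
  destruct (eigenfunction_pair_dichotomy _ _ _ _ _ hL hs hk huv)
    as [u' [v' [_ [_ [hA [hB hne]]]]]].
  apply not_and_or in hne; tauto.
- intros [hA | hB].
  + now apply transmission_wavenumber_of_A.
  + now apply transmission_wavenumber_of_B.
- intros [u [v [huv [ou ov]]]].
  destruct (eigenfunction_pair_dichotomy _ _ _ _ _ hL hs hk huv)
    as [u' [v' [_ [_ [hA [_ hne]]]]]].
  assert (odd_0 : forall f, odd_on L f -> f 0 = 0%C).
  { intros f hf; apply (Cmult_eq_0_reg_l (RtoC 2)); [exact C2_neq0|].
    assert (h : f (- 0) = (- f 0)%C) by (apply hf; unfold interval; lra).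
    rewrite Ropp_0 in h; transitivity (f 0 + f 0)%C; [ring|].
    rewrite h at 1; ring. }
  apply hA; intros h; apply hne; auto.
- intros [u [v [huv [eu ev]]]].
  destruct (eigenfunction_pair_dichotomy _ _ _ _ _ hL hs hk huv)
    as [u' [v' [hu [hv [_ [hB hne]]]]]].
  apply hB; intros h; apply hne; split; [exact h|].
  split; [exact (derivative_on_even L _ _ hL hu eu) | exact (derivative_on_even L _ _ hL hv ev)].
Qed.
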